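(* For every $a\in\mathbb{C}$ there exists a constant $C_1>0$ such that $\widetilde\zeta(s)$ has no $a$-point in the half-plane $\sigma>C_1$.
   Context: Fix an integer $r\ge 2$ and real numbers $a_1\ge a_2\ge\cdots\ge a_r>0$. Write $s=\sigma+it$ with $\sigma,t\in\mathbb{R}$. The Euler-Zagier multiple zeta function is $\zeta(s_1,\dots,s_r)=\sum_{1\le n_1<\cdots<n_r} n_1^{-s_1}\cdots n_r^{-s_r}$, which converges absolutely when $\Re(s_l+\cdots+s_r)>r-l+1$ for all $1\le l\le r$ and is continued meromorphically to $\mathbb{C}^r$. With $\mathfrak{S}_r$ the symmetric group of degree $r$, define the meromorphic function on $\mathbb{C}$ $$\widetilde\zeta(s):=\sum_{\tau\in\mathfrak{S}_r}\zeta(a_{\tau(1)}s,\dots,a_{\tau(r)}s).$$ Equivalently (Hoffman's identity), $\widetilde\zeta(s)=\sum_{l=1}^r\sum_{P_1,\dots,P_l}(-1)^{r-l}\prod_{j=1}^l(\#(P_j)-1)!\,\zeta\bigl(\sum_{j'\in P_j}a_{j'}s\bigr)$, where $\{P_1,\dots,P_l\}$ runs over all partitions of the set $\{1,\dots,r\}$ into $l$ nonempty blocks and $\zeta$ on the right is the Riemann zeta function. An $a$-point of $\widetilde\zeta$ is a solution $s$ of $\widetilde\zeta(s)=a$. *)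

(* Defs.v *)
From HB Require Import structures.
From mathcomp Require Import all_boot all_order all_algebra.
From mathcomp Require Import all_fingroup.
From mathcomp Require Import complex.
From mathcomp Require Import all_classical all_reals all_analysis.

Set Implicit Arguments.
Unset Strict Implicit.
Unset Printing Implicit Defensive.

Import Order.TTheory GRing.Theory Num.Theory.
Import numFieldNormedType.Exports.

Local Open Scope classical_set_scope.
Local Open Scope complex_scope.
Local Open Scope ring_scope.

(* R[i] packed as a numClosedFieldType: the canonical topology and
   normed-module structures are attached to the sort of a numFieldType and are
   not inferred on the bare type R[i]. *)
Definition Cplx (R : realType) : numClosedFieldType := R[i].

Section Meromorphic.
Variables (K : numFieldType) (V : normedModType K).
Implicit Types (f g h : V -> K) (p : V).

Definition holomorphic_at f p := \forall z \near p, differentiable f z.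

(* A meromorphic function is a total function f that is locally a quotient of
   holomorphic functions. The set of points where f is not holomorphic plays
   the role of the polar set; the values of f there are irrelevant. The second
   clause rules out removable singularities: f is holomorphic at every point
   to which its restriction to the regular points extends holomorphically. *)
Definition meromorphic f :=
  (forall p, exists g h,
     [/\ holomorphic_at g p, holomorphic_at h p,
         ~ (\forall z \near p, h z = 0) &
         \forall z \near p, h z != 0 -> f z = g z / h z]) /\
  (forall p g, holomorphic_at g p ->
     (\forall z \near p, holomorphic_at f z -> f z = g z) ->
     holomorphic_at f p).

Definition apoint f (a : K) p := holomorphic_at f p /\ f p = a.

End Meromorphic.

Section EulerZagier.
Variable R : realType.
Local Notation C := (Cplx R).

Definition cexp (z : C) : C :=
  (expR (complex.Re z))%:C *
  (cos (complex.Im z) +i* sin (complex.Im z)).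

Definition natpowN (n : nat) (s : C) : C := cexp (- s * (ln n%:R)%:C).

(* The sum of n_1^{-s_1} ... n_r^{-s_r} over 1 <= n_1 < ... < n_r <= N;
   the ordinal m i < N encodes n_{i+1} = m i + 1. *)
Definition mzeta_partial (r : nat) (s : 'rV[C]_r) (N : nat) : C :=
  \sum_(m : {ffun 'I_r -> 'I_N} |
        [forall i : 'I_r, forall j : 'I_r, (i < j)%N ==> (m i < m j)%N])
    \prod_(i < r) natpowN (m i).+1 (s 0 i).

(* Indices are shifted by one: l : 'I_r stands for the index l + 1, hence the
   bound r - (l + 1) + 1 = r - l. *)
Definition mzeta_domain (r : nat) : set 'rV[C]_r :=
  [set s | forall l : 'I_r,
     (r - l)%:R < complex.Re (\sum_(j < r | (l <= j)%N) s 0 j)].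

(* Z is the meromorphic continuation to C^r of the Euler-Zagier series. *)
Definition is_mzeta (r : nat) (Z : 'rV[C]_r -> C) :=
  meromorphic Z /\
  forall s, mzeta_domain s ->
    holomorphic_at Z s /\ mzeta_partial s N @[N --> \oo] --> Z s.

Definition perm_arg (r : nat) (a : 'I_r -> R) (tau : 'S_r) (s : C) :
  'rV[C]_r := \row_j ((a (tau j))%:C * s).

(* F is the symmetrized function s |-> \sum_tau Z(a_{tau 1} s, ...) as a
   meromorphic function on C; the equation is imposed wherever no summand
   lies on the polar set of Z, which determines F. *)
Definition is_sym_mzeta (r : nat) (a : 'I_r -> R) (Z : 'rV[C]_r -> C)
    (F : C -> C) :=
  meromorphic F /\
  forall s, (forall tau : 'S_r, holomorphic_at Z (perm_arg a tau s)) ->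
    F s = \sum_(tau : 'S_r) Z (perm_arg a tau s).

End EulerZagier.

(* Main.v *)
Require Import Defs.
From HB Require Import structures.
From mathcomp Require Import all_boot all_order all_algebra.
From mathcomp Require Import all_fingroup.
From mathcomp Require Import complex.
From mathcomp Require Import all_classical all_reals all_analysis.
From mathcomp Require Import ring lra.
Import Order.TTheory GRing.Theory Num.Theory.
Import numFieldNormedType.Exports.
Local Open Scope classical_set_scope.
Local Open Scope complex_scope.
Local Open Scope ring_scope.

Set Implicit Arguments.
Unset Strict Implicit.
Unset Printing Implicit Defensive.

(** For large [sigma] every argument [(a_{tau 1} s, ..., a_{tau r} s)] lies in
    the region of convergence of the multiple zeta series, so [F s] is the limit
    of the sums, over the pairs of a permutation [tau] and an increasing tuple
    of integers in [1, N], of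
<<
      \prod_i n_i ^ (- a_(tau i) s) = e^(- s lambda),
      lambda = \sum_i a_(tau i) ln n_i.
>>
    Hence [F] is a general Dirichlet series with nonnegative integer
    multiplicities and frequencies [lambda].  As every [a_i] is positive, the
    smallest frequency [lambda0] is attained on the tuple [(1, ..., r)], the
    other frequencies are at least [lambda0 + d] for some [d > 0]
    ([least_freq]), and [lambda0 > 0] because [2] occurs in that tuple.

    The series converges absolutely at some abscissa [sigma0], and each term
    satisfies
<<
      |e^(- s lambda)| <= e^(- (sigma - sigma0) mu) e^(- sigma0 lambda)
>>
    whenever [mu <= lambda] and [sigma0 <= sigma].  So the part of the series
    with frequencies at least [mu] is [O(e^(- sigma mu))], uniformly in [N]
    ([tail_le]).
    - With [mu = lambda0 > 0], this says that [F s] tends to [0]: it avoids any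
      given nonzero value for large [sigma] ([no_nonzero_apoint]).
    - With [mu = lambda0 + d], it says that the terms of frequency [lambda0],
      which are all equal and therefore cannot cancel, dominate the others:
      [F s] is nonzero for large [sigma] ([no_zero]). *)

(** * Complex exponentials *)

Section ComplexExponential.
Variable R : realType.
Implicit Types z w : Cplx R.

Lemma Re_sum (I : Type) (s : seq I) (P : pred I) (f : I -> Cplx R) :
  complex.Re (\sum_(i <- s | P i) f i) = \sum_(i <- s | P i) complex.Re (f i).
Proof. by apply: (big_morph (@complex.Re R)) => // -[? ?] [? ?]. Qed.

Lemma Re_mulr_real z (x : R) : complex.Re (z * x%:C) = complex.Re z * x.
Proof. by case: z => u v /=; rewrite mulr0 subr0. Qed.

Lemma cexp0 : cexp 0 = 1 :> Cplx R.
Proof. by rewrite /cexp /= expR0 cos0 sin0 mul1r. Qed.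

Lemma cexpD z w : cexp (z + w) = cexp z * cexp w.
Proof.
case: z w => [x y] [x' y']; rewrite /cexp /= expRD cosD sinD rmorphM /=.
rewrite mulrACA; congr (_ * _).
by apply/eqP; rewrite eq_complex /= eqxx /= addrC; apply/eqP; ring.
Qed.

Lemma norm_cexp z : `|cexp z| = (expR (complex.Re z))%:C.
Proof.
rewrite normrM normc_def /= expr0n addr0 sqrtr_sqr.
rewrite (@normc_def R (_ +i* _)) /= cos2Dsin2 sqrtr1 mulr1.
by rewrite ger0_norm ?expR_ge0.
Qed.

Lemma cexp_sum (I : Type) (s : seq I) (P : pred I) (f : I -> Cplx R) :
  \prod_(i <- s | P i) cexp (f i) = cexp (\sum_(i <- s | P i) f i).
Proof. by rewrite (big_morph (@cexp R) cexpD cexp0). Qed.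

End ComplexExponential.

(** * Real estimates *)

Section RealEstimates.
Variable R : realType.

(** Source of all the gaps below: a finite family of reals does not accumulate
    at [0] from above. *)
Lemma finite_pos_lb (I : finType) (f : I -> R) :
  exists2 d, 0 < d & forall i, 0 < f i -> d <= f i.
Proof.
exists (\big[Order.min/1]_(i | 0 < f i) f i) => [|i fi_gt0].
  by apply: lt_bigmin.
exact: bigmin_le_cond.
Qed.

Lemma exp_decay (K d e : R) : 0 < d -> 0 < e ->
  exists C, forall x, C < x -> K * expR (- (x * d)) < e.
Proof.
move=> d0 e0; exists (`|K| / e / d) => x.
rewrite ltr_pdivrMr // ltr_pdivrMr // => Kx.
rewrite expRN ltr_pdivrMr ?expR_gt0 //.
apply: le_lt_trans (ler_norm K) _; apply: lt_le_trans Kx _.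
rewrite mulrC ler_pM2l //; apply: le_trans (expR_ge1Dx _).
by rewrite lerDr.
Qed.

(** The bound [2 - 2 / (N + 1)] is inductive, since
    [1 / x^2 <= 2 / (x (x + 1)) = 2 / x - 2 / (x + 1)] for [x >= 1]. *)
Lemma sum_inv_square_le (N : nat) : \sum_(n < N) (n.+1%:R ^- 2 : R) <= 2.
Proof.
suff H : \sum_(n < N) (n.+1%:R ^- 2 : R) <= 2 - 2 / N.+1%:R.
  by apply: le_trans H _; rewrite gerBl divr_ge0.
elim: N => [|N IHN]; first by rewrite big_ord0 divr1 subrr.
rewrite big_ord_recr /=; apply: le_trans (lerD IHN (lexx _)) _.
have x1 : 1 <= N.+1%:R :> R by rewrite ler1n.
rewrite -[N.+2%:R]natr1; move: (N.+1%:R) x1 => x x1.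
have -> : 2 - 2 / (x + 1) = 2 - 2 / x + 2 / (x * (x + 1)) by field; lra.
rewrite lerD2l -subr_ge0.
have -> : 2 / (x * (x + 1)) - x ^- 2 = (x - 1) / (x ^+ 2 * (x + 1)).
  by field; lra.
by rewrite divr_ge0 ?mulr_ge0 ?sqr_ge0 // ?subr_ge0 //; lra.
Qed.

End RealEstimates.

(** * Frequencies of the symmetrized series *)

Definition incr (r N : nat) (m : {ffun 'I_r -> 'I_N}) : bool :=
  [forall i : 'I_r, forall j : 'I_r, (i < j)%N ==> (m i < m j)%N].

Lemma incr_ge (r N : nat) (m : {ffun 'I_r -> 'I_N}) :
  incr m -> forall i : 'I_r, (i <= m i)%N.
Proof.
move=> /forallP m_incr [i /= ir].
elim: i ir => // i IHi ir; apply: leq_ltn_trans (IHi (ltnW ir)) _.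
by have /forallP/(_ (Ordinal ir))/implyP := m_incr (Ordinal (ltnW ir)); apply.
Qed.

Section Frequencies.
Variables (R : realType) (r : nat) (a : 'I_r -> R).
Hypothesis a_pos : forall i, 0 < a i.
Implicit Types (tau : 'S_r) (m : 'I_r -> nat).

(** The entry [m i] encodes the summation index [m i + 1], so that the tuple
    [(1, ..., r)] is the identity [fun i => i]. *)
Definition freq tau m : R := \sum_i a (tau i) * ln (m i).+1%:R.

Definition sym_partial (s : Cplx R) (N : nat) : Cplx R :=
  \sum_tau mzeta_partial (perm_arg a tau s) N.

Lemma natpowN_prod tau m (s : Cplx R) :
  \prod_i natpowN (m i).+1 (perm_arg a tau s 0 i) =
  cexp (- s * (freq tau m)%:C).
Proof.
rewrite /natpowN cexp_sum /freq rmorph_sum /= mulr_sumr.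
congr cexp; apply: eq_bigr => i _; rewrite mxE rmorphM /=.
by ring.
Qed.

Lemma sym_partialE s N :
  sym_partial s N =
  \sum_(p : 'S_r * {ffun 'I_r -> 'I_N} | incr p.2)
     cexp (- s * (freq p.1 (fun i => p.2 i))%:C).
Proof.
rewrite -(pair_big_dep xpredT (fun _ => @incr r N)
  (fun tau (m : {ffun 'I_r -> 'I_N}) =>
     cexp (- s * (freq tau (fun i => m i))%:C))) /=.
apply: eq_bigr => tau _; apply: eq_bigr => m _.
exact: (natpowN_prod tau (fun i => m i)).
Qed.

Lemma norm_cexp_freq (s : Cplx R) (x : R) :
  `|cexp (- s * x%:C)| = (expR (- (complex.Re s * x)))%:C.
Proof. by rewrite norm_cexp Re_mulr_real; case: s => u v /=; rewrite mulNr. Qed.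

(** One entry exceeding its minimal value [i] already costs
    [a_(tau i) (ln (i + 2) - ln (i + 1))], and these costs form a finite family
    of positive numbers. *)
Lemma freq_gap : exists2 d : R, 0 < d &
  forall tau m, (forall i : 'I_r, (i <= m i)%N) ->
    (exists i : 'I_r, m i != i) ->
    freq tau (fun i => i) + d <= freq tau m.
Proof.
pose gap (i : 'I_r * 'I_r) : R := a i.1 * (ln i.2.+2%:R - ln i.2.+1%:R).
have [d d0 d_le] := finite_pos_lb gap.
exists d => // tau m m_ge [i mi].
rewrite /freq (bigD1 i) //= [leRHS](bigD1 i) //= addrAC.
apply: lerD; last first.
  apply: ler_sum => j _; apply: ler_wpM2l; first exact: ltW.
  by rewrite ler_ln ?posrE // ler_nat ltnS.
have im : (i < m i)%N by rewrite ltn_neqAle eq_sym mi m_ge.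
rewrite -lerBrDl -mulrBr.
apply: (@le_trans _ _ (gap (tau i, i))).
  by apply: d_le; rewrite mulr_gt0 // subr_gt0 ltr_ln ?posrE // ltr_nat.
apply: ler_wpM2l; first exact: ltW.
by rewrite lerD2r ler_ln ?posrE // ler_nat ltnS.
Qed.

(** A frequency above the least one comes either from the tuple [(1, ..., r)]
    with a permutation that is not optimal, which leaves finitely many values,
    or from another tuple, which [freq_gap] handles. *)
Lemma least_freq : exists tau0, exists2 d : R, 0 < d &
  forall N (p : 'S_r * {ffun 'I_r -> 'I_N}), incr p.2 ->
    freq p.1 (fun i => p.2 i) = freq tau0 (fun i => i) \/
    freq tau0 (fun i => i) + d <= freq p.1 (fun i => p.2 i).
Proof.
pose f tau := freq tau (fun i => i).
have [tau0 _ tau0_min] := @arg_minP _ _ _ (1%g : 'S_r) xpredT f isT.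
have [d1 d1_gt0 d1_le] := finite_pos_lb (fun tau => f tau - f tau0).
have [d2 d2_gt0 d2_le] := freq_gap.
exists tau0, (Order.min d1 d2); first by rewrite lt_min d1_gt0.
move=> N [tau m] /= /incr_ge m_ge.
have [/forallP m_id|/forallPn m_id] := boolP [forall i, m i == i :> nat];
  last first.
  right; apply: le_trans (d2_le tau (fun i => m i) m_ge m_id).
  by rewrite lerD ?tau0_min // ge_min lexx orbT.
have -> : freq tau (fun i => m i) = f tau.
  by apply: eq_bigr => i _; rewrite (eqP (m_id i)).
have := tau0_min tau isT; rewrite le_eqVlt => /predU1P[tauE|tau_gt].
  by left.
right; rewrite -lerBrDl (le_trans _ (d1_le tau _)) ?subr_gt0 //.
by rewrite ge_min lexx.
Qed.

(** The entry [2] of [(1, ..., r)] has a positive logarithm. *)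
Lemma freq_id_gt0 tau : (2 <= r)%N -> 0 < freq tau (fun i => i).
Proof.
move=> r2; rewrite /freq (bigD1 (Ordinal r2)) //=.
apply: ltr_pwDl; first by rewrite mulr_gt0 // ln_gt0 // ltr1n.
by apply: sumr_ge0 => i _; rewrite mulr_ge0 ?ln_ge0 ?ler1n // ltW.
Qed.

(** Any [sigma0] as below is an abscissa of absolute convergence: there each
    factor [n ^ (- a_i sigma0)] is at most [n ^ -2]. *)
Lemma abscissa_exists : exists sigma0, forall i, 2 <= sigma0 * a i.
Proof.
have [d d0 d_le] := finite_pos_lb a.
by exists (2 / d) => i; rewrite mulrAC ler_pdivlMr // ler_pM2l // d_le.
Qed.

Variable sigma0 : R.
Hypothesis sigma0_ge : forall i, 2 <= sigma0 * a i.

Lemma gt_abscissa (sigma : R) : sigma0 < sigma -> forall i, 1 < a i * sigma.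
Proof.
move=> s_gt i; have s_gt' : sigma0 * a i < sigma * a i by rewrite ltr_pM2r.
by have := sigma0_ge i; lra.
Qed.

(** Dropping the monotonicity of the tuples makes the sum factor into [r] sums
    over a single index, each at most [\sum_n n ^ -2 <= 2]. *)
Lemma sum_expR_freq_le tau N :
  \sum_(m : {ffun 'I_r -> 'I_N}) expR (- (sigma0 * freq tau (fun i => m i)))
    <= 2 ^+ r.
Proof.
under eq_bigr => m _ do rewrite -mulrN -sumrN mulr_sumr expR_sum.
rewrite -(bigA_distr_bigA (fun i (n : 'I_N) =>
  expR (sigma0 * - (a (tau i) * ln n.+1%:R)))) /=.
rewrite -[X in _ ^+ X]card_ord -prodr_const.
apply: ler_prod => i _; rewrite sumr_ge0 => [/=|n _]; last exact: expR_ge0.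
apply: le_trans (sum_inv_square_le R N); apply: ler_sum => n _.
rewrite mulrN expRN mulrA lef_pV2 ?posrE ?expR_gt0 ?exprn_gt0 //.
rewrite -[leLHS]lnK ?posrE ?exprn_gt0 // ler_expR lnXn //.
by rewrite -[_ *+ 2]mulr_natl; apply: ler_wpM2r; rewrite ?ln_ge0 ?ler1n.
Qed.

Definition tail_const : R := #|{: 'S_r}|%:R * 2 ^+ r.

(** Writing [sigma lambda = (sigma - sigma0) lambda + sigma0 lambda] with
    [lambda >= x] extracts the decay in [sigma]; what is left is the sum at
    [sigma0], which does not depend on [sigma] and is bounded uniformly
    in [N]. *)
Lemma tail_le N (P : pred ('S_r * {ffun 'I_r -> 'I_N})) (x sigma : R) :
  sigma0 <= sigma ->
  (forall p, P p -> x <= freq p.1 (fun i => p.2 i)) ->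
  \sum_(p | P p) expR (- (sigma * freq p.1 (fun i => p.2 i))) <=
  tail_const * expR (- ((sigma - sigma0) * x)).
Proof.
move=> sigma_ge x_le; rewrite mulrC.
apply: (@le_trans _ _ (\sum_(p | P p) expR (- ((sigma - sigma0) * x)) *
    expR (- (sigma0 * freq p.1 (fun i => p.2 i))))).
  apply: ler_sum => p Pp; rewrite -expRD ler_expR.
  have := ler_wpM2l (_ : 0 <= sigma - sigma0) (x_le p Pp).
  by rewrite subr_ge0 => /(_ sigma_ge); lra.
rewrite -mulr_sumr; apply: ler_wpM2l; first exact: expR_ge0.
apply: (@le_trans _ _ (\sum_(p : 'S_r * {ffun 'I_r -> 'I_N})
    expR (- (sigma0 * freq p.1 (fun i => p.2 i))))).
  by rewrite [leRHS](bigID P) /= lerDl sumr_ge0 // => p _; apply: expR_ge0.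
rewrite -(pair_big xpredT xpredT (fun tau (m : {ffun 'I_r -> 'I_N}) =>
  expR (- (sigma0 * freq tau (fun i => m i))))) /=.
rewrite /tail_const mulr_natl -sumr_const; apply: ler_sum => tau _.
exact: sum_expR_freq_le.
Qed.

Lemma norm_tail_le N (P : pred ('S_r * {ffun 'I_r -> 'I_N})) x (s : Cplx R) :
  sigma0 <= complex.Re s ->
  (forall p, P p -> x <= freq p.1 (fun i => p.2 i)) ->
  `|\sum_(p | P p) cexp (- s * (freq p.1 (fun i => p.2 i))%:C)| <=
  (tail_const * expR (- ((complex.Re s - sigma0) * x)))%:C.
Proof.
move=> s_ge x_le; apply: le_trans (ler_norm_sum _ _ _) _.
under eq_bigr => p _ do rewrite norm_cexp_freq.
by rewrite -rmorph_sum lecR; apply: tail_le.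
Qed.

(** The terms of least frequency are equal complex numbers, so their sum has
    modulus at least that of one of them; such a term is present as soon as the
    tuple [(1, ..., r)] fits below [N]. *)
Lemma norm_sym_partial_ge N tau0 (d : R) (s : Cplx R) :
  (r <= N)%N -> sigma0 <= complex.Re s ->
  (forall p : 'S_r * {ffun 'I_r -> 'I_N}, incr p.2 ->
    freq p.1 (fun i => p.2 i) = freq tau0 (fun i => i) \/
    freq tau0 (fun i => i) + d <= freq p.1 (fun i => p.2 i)) ->
  (expR (- (complex.Re s * freq tau0 (fun i => i))) -
   tail_const * expR (- ((complex.Re s - sigma0) *
                (freq tau0 (fun i => i) + d))))%:C <=
  `|sym_partial s N|.
Proof.
set x := freq tau0 _ => rN s_ge gap; rewrite sym_partialE.
rewrite (bigID (fun p : 'S_r * {ffun 'I_r -> 'I_N} =>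
  freq p.1 (fun i => p.2 i) == x)) /=.
apply: le_trans (lerB_normD _ _); rewrite rmorphB; apply: lerB; last first.
  apply: norm_tail_le => // p /andP[/gap[->|//]].
  by rewrite eqxx.
rewrite (eq_bigr (fun=> cexp (- s * x%:C))) => [|p /andP[_ /eqP-> //]].
rewrite sumr_const normrMn norm_cexp_freq -rmorphMn lecR.
rewrite -[leLHS]mulr1n ler_wpMn2l ?expR_ge0 //.
(* The tuple (1, ..., r), read as a function with values below N. *)
apply/card_gt0P; exists (tau0, [ffun i => widen_ord rN i]).
rewrite unfold_in /=; apply/andP; split.
  by apply/forallP => i; apply/forallP => j; apply/implyP; rewrite !ffunE.
by apply/eqP; apply: eq_bigr => i _; rewrite ffunE.
Qed.

End Frequencies.

(** * Convergence to the symmetrized function, and its values *)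

Section Convergence.
Variables (R : realType) (r : nat) (a : 'I_r -> R).
Variables (Z : 'rV[Cplx R]_r -> Cplx R) (F : Cplx R -> Cplx R).
Hypotheses (Z_mzeta : is_mzeta Z) (F_sym : is_sym_mzeta a Z F).

Lemma perm_arg_domain tau (s : Cplx R) :
  (forall i, 1 < a i * complex.Re s) -> mzeta_domain (perm_arg a tau s).
Proof.
move=> as_gt1 l; rewrite /= Re_sum.
have -> : (r - l)%:R = \sum_(j < r | (l <= j)%N) 1 :> R.
  by rewrite -(big_geq_mkord l r xpredT (fun=> 1)) sumr_const_nat.
apply: ltr_sum => [|j _]; last first.
  by rewrite mxE mulrC Re_mulr_real mulrC.
by apply/hasP; exists l; rewrite ?mem_index_enum /=.
Qed.

(** In the region of convergence [Z] is holomorphic, so the equation that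
    determines [F] holds at [s] itself. *)
Lemma cvg_sym_partial (s : Cplx R) :
  (forall i, 1 < a i * complex.Re s) ->
  sym_partial a s N @[N --> \oo] --> F s.
Proof.
move=> as_gt1.
have Zs tau := Z_mzeta.2 _ (perm_arg_domain tau as_gt1).
rewrite F_sym.2 => [|tau]; last by case: (Zs tau).
by apply: cvg_big => [|tau _]; [exact: add_continuous | case: (Zs tau)].
Qed.

Hypotheses (a_pos : forall i, 0 < a i) (r2 : (2 <= r)%N).

Lemma no_nonzero_apoint (z : Cplx R) : z != 0 ->
  exists C, forall s, C < complex.Re s -> F s <> z.
Proof.
move=> z0; have [sigma0 sigma0_ge] := abscissa_exists a_pos.
have [tau0 [d d0 gap]] := least_freq a_pos.
pose x : R := freq a tau0 (fun i => i).
have x0 : 0 < x by apply: freq_id_gt0.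
have nz0 : 0 < Normc.normc z.
  by rewrite -ltcR; have : 0 < `|z| by rewrite normr_gt0.
have [C C_lt] := exp_decay (tail_const R r * expR (sigma0 * x)) x0
  (divr_gt0 nz0 (ltr0Sn _ 1)).
exists (Order.max sigma0 C) => s; rewrite gt_max => /andP[s0 sC] Fs.
have := cvg_sym_partial (gt_abscissa a_pos sigma0_ge s0).
rewrite Fs => /cvgr_dist_lt /(_ (Normc.normc z / 2)%:C).
rewrite ltcR divr_gt0 // => /(_ isT) [N _ /(_ N (leqnn N))] /= close.
suff : `|z| < `|z| by rewrite ltxx.
(* |z| <= |z - S_N| + |S_N| < |z| / 2 + |z| / 2 for a partial sum S_N close
   to F s = z. *)
rewrite -{1}[z](subrK (sym_partial a s N)).
apply: le_lt_trans (ler_normD _ _) _.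
have -> : `|z| = (Normc.normc z / 2)%:C + (Normc.normc z / 2)%:C.
  by rewrite -rmorphD /= -splitr.
apply: ltr_leD close _; rewrite sym_partialE.
apply: le_trans (norm_tail_le sigma0_ge (x := x) (ltW s0) _) _.
  move=> p /gap[->//|]; apply: le_trans; rewrite lerDl ltW //.
rewrite lecR; apply: le_trans (ltW (C_lt _ sC)); rewrite -mulrA -expRD.
by rewrite mulrBl opprB addrC lexx.
Qed.

Lemma no_zero : exists C, forall s, C < complex.Re s -> F s <> 0.
Proof.
have [sigma0 sigma0_ge] := abscissa_exists a_pos.
have [tau0 [d d0 gap]] := least_freq a_pos.
pose x : R := freq a tau0 (fun i => i).
have half0 : 0 < 1 / 2 :> R by [].
have [C C_lt] := exp_decay (tail_const R r * expR (sigma0 * (x + d))) d0 half0.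
exists (Order.max sigma0 C) => s; rewrite gt_max => /andP[s0 sC] Fs.
have := cvg_sym_partial (gt_abscissa a_pos sigma0_ge s0).
pose e : R := expR (- (complex.Re s * x)).
rewrite Fs => /cvgr_dist_lt /(_ (e / 2)%:C).
rewrite ltcR divr_gt0 ?expR_gt0 // => /(_ isT) [N0 _ close].
have {close} := close (maxn N0 r) (leq_maxl _ _).
rewrite /= sub0r normrN => /lt_geF/negP; apply.
apply: le_trans (norm_sym_partial_ge sigma0_ge (leq_maxr _ _) (ltW s0)
  (gap _)); rewrite lecR -/x -/e.
(* Relative to the dominant modulus e, the remaining terms decay like
   e^(- sigma d). *)
have -> : expR (- ((complex.Re s - sigma0) * (x + d))) =
    expR (sigma0 * (x + d)) * expR (- (complex.Re s * d)) * e.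
  by rewrite -!expRD; congr expR; ring.
rewrite !mulrA; have := C_lt _ sC.
move: (_ * expR (- (complex.Re s * d))) => y y_lt.
have e0 : 0 < e := expR_gt0 _.
by nra.
Qed.

End Convergence.

Theorem theorem1p1 (R : realType) (r : nat) (a_ : 'I_r -> R)
  (hr : (2 <= r)%N)
  (a_noninc : forall i j : 'I_r, (i <= j)%N -> a_ j <= a_ i)
  (a_pos : forall i : 'I_r, 0 < a_ i)
  (Z : 'rV[Cplx R]_r -> Cplx R) (Z_mzeta : is_mzeta Z)
  (F : Cplx R -> Cplx R) (F_sym : is_sym_mzeta a_ Z F) :
  forall a : Cplx R, exists C1 : R, 0 < C1 /\
    forall s : Cplx R, C1 < complex.Re s -> ~ apoint F a s.
Proof.
move=> a.
have [C C_lt] : exists C, forall s, C < complex.Re s -> F s <> a.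
  have [->|a0] := eqVneq a 0; first exact: (no_zero Z_mzeta F_sym).
  exact: (no_nonzero_apoint Z_mzeta F_sym).
exists (Order.max 1 C); split=> [|s]; first by rewrite lt_max ltr01.
by rewrite gt_max => /andP[_ sC] [_]; apply: C_lt.
Qed.
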